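(* Let $\sigma=\sigma_1\mathbf{s}^M\sigma_2$ and $\sigma'=\sigma_1\mathbf{s}^{M'}\sigma_2$ be elements of $(2^{\mathrm{AT}})^\omega$, where $\sigma_1$ is a finite word, $\mathbf{s}$ a nonempty finite word and $\sigma_2$ an $\omega$-word over $2^{\mathrm{AT}}$, and let $i,i'\in\mathbb{N}$ and $N\ge 2$ be such that $M,M'\ge 2N+1$ and $(\sigma,i)\equiv_N(\sigma',i')$. Then for every $\mathrm{PLTL}[\emptyset]$ formula $\varphi$ with temporal depth at most $N$, we have $\sigma,i\models\varphi$ iff $\sigma',i'\models\varphi$.
   Context: $\mathrm{PLTL}[\emptyset]$ formulae: $\varphi::=p\mid\neg\varphi\mid\varphi\wedge\varphi\mid\varphi\vee\varphi\mid\mathtt{X}\varphi\mid\varphi\mathtt{U}\varphi\mid\mathtt{X}^{-1}\varphi\mid\varphi\mathtt{S}\varphi$ with $p\in\mathrm{AT}$, interpreted over $\sigma\in(2^{\mathrm{AT}})^\omega$: $\sigma,i\models p$ iff $p\in\sigma(i)$; $\sigma,i\models\mathtt{X}\varphi$ iff $\sigma,i+1\models\varphi$; $\sigma,i\models\varphi_1\mathtt{U}\varphi_2$ iff some $j\ge i$ has $\sigma,j\models\varphi_2$ and $\sigma,k\models\varphi_1$ for $i\le k<j$; $\sigma,i\models\mathtt{X}^{-1}\varphi$ iff $i>0$ and $\sigma,i-1\models\varphi$; $\sigma,i\models\varphi_1\mathtt{S}\varphi_2$ iff some $0\le j\le i$ has $\sigma,j\models\varphi_2$ and $\sigma,k\models\varphi_1$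 for $j<k\le i$. The temporal depth of $\varphi$ is the maximal nesting of temporal operators in $\varphi$. For $M,M',N\in\mathbb{N}$, $M\approx_N M'$ iff $\min(M,N)=\min(M',N)$. For $w=w_1u^Mw_2$, $w'=w_1u^{M'}w_2$ ($w_1$ finite, $u$ nonempty finite, $w_2$ infinite; $|x|$ is length) and $i,i'\in\mathbb{N}$, $(w,i)\equiv_N(w',i')$ iff $M\approx_{2N}M'$ and one of: (1) $i,i'<|w_1|+N|u|$ and $i=i'$; (2) $i\ge|w_1|+(M-N)|u|$, $i'\ge|w_1|+(M'-N)|u|$ and $i-i'=(M-M')|u|$; (3) $|w_1|+N|u|\le i<|w_1|+(M-N)|u|$, $|w_1|+N|u|\le i'<|w_1|+(M'-N)|u|$ and $|i-i'|\equiv 0 \bmod |u|$. *)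

(* Defs.v *)
From mathcomp Require Import all_boot all_order all_algebra.

Set Implicit Arguments.
Unset Strict Implicit.
Unset Printing Implicit Defensive.

Definition letter (AT : Type) : Type := AT -> Prop.

Definition omega_word (A : Type) : Type := nat -> A.

(* Concatenation of a finite word with an omega-word; [nth] returns its default
   value exactly at the positions n >= size w. *)
Definition omega_cat (A : Type) (w : seq A) (v : omega_word A) : omega_word A :=
  fun n => nth (v (n - size w)) w n.

Definition word_pow (A : Type) (u : seq A) (M : nat) : seq A :=
  flatten (nseq M u).

Inductive pltl (AT : Type) : Type :=
| Atom of AT
| Not of pltl AT
| And of pltl AT & pltl AT
| Or of pltl AT & pltl AT
| Next of pltl AT
| Until of pltl AT & pltl AT
| Previous of pltl AT
| Since of pltl AT & pltl AT.

Fixpoint temporal_depth (AT : Type) (phi : pltl AT) : nat :=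
  match phi with
  | Atom _ => 0
  | Not f => temporal_depth f
  | And f g | Or f g => maxn (temporal_depth f) (temporal_depth g)
  | Next f | Previous f => (temporal_depth f).+1
  | Until f g | Since f g => (maxn (temporal_depth f) (temporal_depth g)).+1
  end.

Fixpoint sat (AT : Type) (sigma : omega_word (letter AT)) (i : nat)
    (phi : pltl AT) : Prop :=
  match phi with
  | Atom p => sigma i p
  | Not f => ~ sat sigma i f
  | And f g => sat sigma i f /\ sat sigma i g
  | Or f g => sat sigma i f \/ sat sigma i g
  | Next f => sat sigma i.+1 f
  | Until f g =>
      exists j : nat, [/\ i <= j, sat sigma j g
        & forall k : nat, i <= k < j -> sat sigma k f]
  | Previous f => 0 < i /\ sat sigma i.-1 f
  | Since f g =>
      exists j : nat, [/\ j <= i, sat sigma j g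
        & forall k : nat, j < k <= i -> sat sigma k f]
  end.

Definition thr_eq (N M M' : nat) : Prop := minn M N = minn M' N.

Section PosEquiv.
Import GRing.Theory Num.Theory.
Local Open Scope ring_scope.

(* (w, i) and (w', i') are N-equivalent for w = w1 u^M w2 and w' = w1 u^M' w2.
   The relation depends on the chosen factorizations, not only on the words w
   and w'; the common suffix w2 plays no role.  Differences are taken in int,
   because subtraction on nat truncates. *)
Definition pos_equiv (A : Type) (N : nat) (w1 u : seq A) (M M' i i' : nat) :
    Prop :=
  thr_eq (2 * N) M M' /\
  [\/ [/\ (i < size w1 + N * size u)%N, (i' < size w1 + N * size u)%N & i = i'],
      [/\ (size w1)%:Z + (M%:Z - N%:Z) * (size u)%:Z <= i%:Z,
          (size w1)%:Z + (M'%:Z - N%:Z) * (size u)%:Z <= i'%:Z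
        & i%:Z - i'%:Z = (M%:Z - M'%:Z) * (size u)%:Z]
    | [/\ (size w1 + N * size u <= i)%N
            /\ i%:Z < (size w1)%:Z + (M%:Z - N%:Z) * (size u)%:Z,
          (size w1 + N * size u <= i')%N
            /\ i'%:Z < (size w1)%:Z + (M'%:Z - N%:Z) * (size u)%:Z
        & (`|i%:Z - i'%:Z| = 0 %[mod size u])%N]].

End PosEquiv.

(* Main.v *)
Require Import Defs.
From mathcomp Require Import all_boot all_order all_algebra.
From mathcomp Require Import zify.

Set Implicit Arguments.
Unset Strict Implicit.
Unset Printing Implicit Defensive.

(** An Ehrenfeucht-Fraisse argument.  Below [lo] the two words coincide, from
    [hi] (resp. [hi']) on they coincide up to a shift, and in between both are
    [L]-periodic with the same phase.  One temporal operator costs one period at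
    each border of the periodic zone: as long as this zone contains a full
    period, every witness of an Until or a Since in one word can be copied to the
    other, moving it by a multiple of [L] if it lies in the zone, and so that each
    position crossed in the second word matches one crossed in the first. *)

(* Kept folded so that [lia] does not expand the euclidean divisions. *)
Definition eqmod (L i i' : nat) : Prop := i = i' %[mod L].

(** The naturals [hi] and [hi'] replace the integer borders of [pos_equiv], and the additive
    equation of [ZoneSuffix] avoids truncated subtraction. *)
Inductive zone_equiv (L lo hi hi' i i' : nat) : Prop :=
| ZonePrefix of i = i' & i < lo
| ZoneSuffix of hi <= i & hi' <= i' & i + hi' = i' + hi
| ZoneMiddle of lo <= i < hi & lo <= i' < hi' & eqmod L i i'.

(** * Congruence modulo the period *)

Lemma eqmod_shift L i i' k k' :
  eqmod L i i' -> k + i' = k' + i -> eqmod L k k'.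
Proof.
by move=> /eqP eq_ii' e; apply/eqP; rewrite -(eqn_modDr i') e eqn_modDl.
Qed.

Lemma eqmod_sym L i i' : eqmod L i i' -> eqmod L i' i.
Proof. exact: esym. Qed.

Lemma eqmod_trans L i j k : eqmod L i j -> eqmod L j k -> eqmod L i k.
Proof. exact: etrans. Qed.

Lemma eqmod_leq L i i' : eqmod L i i' -> i < i' + L -> i <= i'.
Proof.
move=> e lt_i; rewrite leqNgt; apply/negP => lt_i'.
have : L %| i - i' by rewrite -eqn_mod_dvd; [apply/eqP | exact: ltnW].
by move/dvdn_leq; lia.
Qed.

Lemma residue_from L lo x : 0 < L ->
  exists2 y, lo <= y < lo + L & eqmod L y x.
Proof.
(* [lo * L.-1] is congruent to [-lo], so the sum stands for [x - lo] without truncation. *)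
move=> L_gt0; exists (lo + (x + lo * L.-1) %% L).
  by have := ltn_pmod (x + lo * L.-1) L_gt0; move: (_ %% L) => r; lia.
by rewrite /eqmod modnDmr addnCA -mulnS prednK // addnC modnMDl.
Qed.

Lemma zone_equiv_sym L lo hi hi' i i' :
  zone_equiv L lo hi hi' i i' -> zone_equiv L lo hi' hi i' i.
Proof.
case=> [<- ?|? ? e|? ? e]; first exact: ZonePrefix.
- exact: ZoneSuffix.
- by apply: ZoneMiddle (eqmod_sym e).
Qed.

(** * Moves of the game, one for each temporal operator *)

Section BackAndForth.

Variables (L lo hi hi' : nat).
Hypothesis L_gt0 : 0 < L.
Hypotheses (le_hi : lo + 2 * L <= hi) (le_hi' : lo + 2 * L <= hi').
Hypothesis eq_hi : eqmod L hi hi'.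

(** [outer] relates the positions where a temporal operator is evaluated, [inner] those where its
    arguments are. *)
Notation outer := (zone_equiv L (lo + L) hi hi').
Notation inner := (zone_equiv L lo (hi + L) (hi' + L)).

Lemma inner_prefix i : i < lo + 2 * L -> inner i i.
Proof.
move=> lt_i; case: (ltnP i lo) => ?; first exact: ZonePrefix.
by apply: ZoneMiddle => //; lia.
Qed.

(** As [hi] and [hi'] are congruent, positions aligned from the right are also in phase inside the
    middle zone. *)
Lemma inner_suffix i i' :
  lo <= i -> lo <= i' -> i + hi' = i' + hi -> inner i i'.
Proof.
move=> le_i le_i' e.
case: (ltnP i (hi + L)) => ?; last by apply: ZoneSuffix; lia.
by apply: ZoneMiddle; try lia; apply: eqmod_shift eq_hi _; lia.
Qed.

Lemma outer_inner i i' : outer i i' -> inner i i'.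
Proof.
case=> [<- ?|? ? ?|? ? e].
- by apply: inner_prefix; lia.
- by apply: inner_suffix; lia.
- by apply: ZoneMiddle e; lia.
Qed.

Lemma next_forth i i' : outer i i' -> inner i.+1 i'.+1.
Proof.
case=> [<- ?|? ? ?|? ? e].
- by apply: inner_prefix; lia.
- by apply: inner_suffix; lia.
- by apply: ZoneMiddle; try lia; apply: eqmod_shift e _; lia.
Qed.

Lemma previous_forth i i' :
  outer i i' -> 0 < i -> 0 < i' /\ inner i.-1 i'.-1.
Proof.
case=> [<- ?|? ? ?|? ? e] i_gt0; split; try lia;
  [apply: inner_prefix | apply: inner_suffix | apply: ZoneMiddle]; try lia.
by apply: eqmod_shift e _; lia.
Qed.

Lemma until_forth i i' j : outer i i' -> i <= j ->
  exists j', [/\ i' <= j', inner j j'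
    & forall k', i' <= k' < j' -> exists2 k, i <= k < j & inner k k'].
Proof.
case=> [<- lt_i|le_i le_i' e|mid_i mid_i' e] le_ij.
- case: (ltnP j (lo + L)) => [lt_j|ge_j].
    exists j; split=> // [|k' lt_k']; first by apply: inner_prefix; lia.
    by exists k' => //; apply: inner_prefix; lia.
  case: (ltnP j hi) => [lt_j|ge_j'].
    (* The first copy of [j] from [lo + L] on lies below [lo + 2 * L], so every position crossed
       before it matches itself. *)
    have [j' range_j' eq_j'] := residue_from (lo + L) j L_gt0.
    have le_j' : j' <= j by apply: eqmod_leq eq_j' _; lia.
    exists j'; split=> [||k' lt_k']; first lia.
      by apply: ZoneMiddle (eqmod_sym eq_j'); lia.
    by exists k'; [lia | apply: inner_prefix; lia].
  exists (j + hi' - hi); split=> [||k' lt_k']; first lia.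
    by apply: inner_suffix; lia.
  case: (ltnP k' (lo + L)) => [lt_k|ge_k].
    by exists k'; [lia | apply: inner_prefix; lia].
  case: (ltnP k' hi') => [lt_k'2|ge_k'].
    (* Since [i < lo + L] and [lo + 2 * L <= hi <= j], the first word crosses this whole window,
       which contains every residue. *)
    have [k range_k eq_k] := residue_from (lo + L) k' L_gt0.
    by exists k; [lia | apply: ZoneMiddle eq_k; lia].
  by exists (k' + hi - hi'); [lia | apply: inner_suffix; lia].
- exists (j + hi' - hi); split=> [||k' lt_k']; first lia.
    by apply: inner_suffix; lia.
  by exists (k' + hi - hi'); [lia | apply: inner_suffix; lia].
- case: (ltnP j (hi + L)) => [lt_j|ge_j].
    (* This copy of [j] is less than one period after [i]; as [i' < hi'], its translate stays below
       [hi' + L]. *)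
    have [j' range_j' eq_j'] := residue_from i j L_gt0.
    have le_j' : j' <= j by apply: eqmod_leq eq_j' _; lia.
    exists (j' + i' - i); split=> [||k' lt_k']; first lia.
      apply: ZoneMiddle; try lia.
      by apply: eqmod_trans (eqmod_sym eq_j') _; apply: eqmod_shift e _; lia.
    exists (k' + i - i'); first lia.
    by apply: ZoneMiddle; try lia; apply: eqmod_shift e _; lia.
  exists (j + hi' - hi); split=> [||k' lt_k']; first lia.
    by apply: inner_suffix; lia.
  case: (ltnP k' (hi' + L)) => [lt_k'2|ge_k'].
    have [k range_k eq_k] := residue_from i k' L_gt0.
    by exists k; [lia | apply: ZoneMiddle eq_k; lia].
  by exists (k' + hi - hi'); [lia | apply: inner_suffix; lia].
Qed.

Lemma since_forth i i' j : outer i i' -> j <= i ->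
  exists j', [/\ j' <= i', inner j j'
    & forall k', j' < k' <= i' -> exists2 k, j < k <= i & inner k k'].
Proof.
case=> [<- lt_i|le_i le_i' e|mid_i mid_i' e] le_ji.
- exists j; split=> // [|k' lt_k']; first by apply: inner_prefix; lia.
  by exists k' => //; apply: inner_prefix; lia.
- case: (leqP hi j) => [ge_j|lt_j].
    exists (j + hi' - hi); split=> [||k' lt_k']; first lia.
      by apply: inner_suffix; lia.
    by exists (k' + hi - hi'); [lia | apply: inner_suffix; lia].
  case: (leqP (lo + L) j) => [ge_j|lt_j'].
    (* Mirror image of Until: the last copy of [j] before [hi], then translated along with the
       suffix. *)
    have [j' range_j' eq_j'] := residue_from (hi - L) j L_gt0.
    have le_j' : j <= j' by apply: eqmod_leq (eqmod_sym eq_j') _; lia.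
    exists (j' + hi' - hi); split=> [||k' lt_k']; first lia.
      apply: ZoneMiddle; try lia.
      apply: eqmod_trans (eqmod_sym eq_j') _.
      by apply: eqmod_shift eq_hi _; lia.
    by exists (k' + hi - hi'); [lia | apply: inner_suffix; lia].
  exists j; split=> [||k' lt_k']; first lia.
    by apply: inner_prefix; lia.
  case: (ltnP k' (lo + L)) => [lt_k|ge_k].
    by exists k'; [lia | apply: inner_prefix; lia].
  case: (ltnP k' hi') => [lt_k'2|ge_k'].
    have [k range_k eq_k] := residue_from (lo + L) k' L_gt0.
    by exists k; [lia | apply: ZoneMiddle eq_k; lia].
  by exists (k' + hi - hi'); [lia | apply: inner_suffix; lia].
- case: (leqP lo j) => [ge_j|lt_j].
    (* Starting at [i.+1 - L] makes the window end at [i] itself, a possible witness; [lo + L <= i]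
       excludes truncation. *)
    have [j' range_j' eq_j'] := residue_from (i.+1 - L) j L_gt0.
    have le_j' : j <= j' by apply: eqmod_leq (eqmod_sym eq_j') _; lia.
    exists (j' + i' - i); split=> [||k' lt_k']; first lia.
      apply: ZoneMiddle; try lia.
      by apply: eqmod_trans (eqmod_sym eq_j') _; apply: eqmod_shift e _; lia.
    exists (k' + i - i'); first lia.
    by apply: ZoneMiddle; try lia; apply: eqmod_shift e _; lia.
  exists j; split=> [||k' lt_k']; first lia.
    by apply: inner_prefix; lia.
  case: (ltnP k' lo) => [lt_k|ge_k].
    by exists k'; [lia | apply: inner_prefix; lia].
  have [k range_k eq_k] := residue_from (i.+1 - L) k' L_gt0.
  by exists k; [lia | apply: ZoneMiddle eq_k; lia].
Qed.

End BackAndForth.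

(** * Letters of pumped words *)

Lemma size_word_pow (A : Type) (u : seq A) M : size (word_pow u M) = M * size u.
Proof. by elim: M => //= M IH; rewrite /word_pow /= size_cat IH mulSn. Qed.

Lemma nth_word_pow (A : Type) (x : A) (u : seq A) M n :
  n < M * size u -> nth x (word_pow u M) n = nth x u (n %% size u).
Proof.
elim: M n => // M IH n lt_n; rewrite /word_pow /= nth_cat.
case: ltnP => [lt_nu|le_un]; first by rewrite modn_small.
rewrite -/(word_pow u M) IH; last by rewrite mulSn in lt_n; lia.
by rewrite -{2}(subnK le_un) modnDr.
Qed.

Section Pumping.

Variables (AT : Type) (w1 u : seq (letter AT)) (w2 : omega_word (letter AT)).
Hypothesis u_gt0 : 0 < size u.

Notation pumped M := (omega_cat (w1 ++ word_pow u M) w2).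
(** The number [n] of copies of [u] cut off at each end of the power is the budget of nested
    temporal operators. *)
Notation level n M M' :=
  (zone_equiv (size u) (size w1 + n * size u) (size w1 + (M - n) * size u)
     (size w1 + (M' - n) * size u)).

Lemma pumped_periodic M i x : size w1 <= i < size w1 + M * size u ->
  pumped M i = nth x u ((i - size w1) %% size u).
Proof.
move=> range_i; rewrite /omega_cat nth_cat ifF; last by lia.
by rewrite nth_word_pow; [apply: set_nth_default; rewrite ltn_pmod | lia].
Qed.

Lemma pumped_prefix M M' i : i < size w1 -> pumped M i = pumped M' i.
Proof.
by move=> lt_i; rewrite /omega_cat !nth_cat lt_i; apply: set_nth_default.
Qed.

Lemma pumped_suffix M i : size w1 + M * size u <= i ->
  pumped M i = w2 (i - (size w1 + M * size u)).
Proof.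
by move=> le_i; rewrite /omega_cat nth_default size_cat size_word_pow.
Qed.

Lemma pumped_zone0 M M' i i' : level 0 M M' i i' -> pumped M i = pumped M' i'.
Proof.
rewrite !subn0; case=> [<- lt_i|le_i le_i' e|mid_i mid_i' e].
- by apply: pumped_prefix; lia.
- by rewrite !pumped_suffix //; congr w2; lia.
(* Any letter can serve as the default of [nth], the index being reduced modulo [size u]. *)
- have x : letter AT by exact: w2 0.
  rewrite !(pumped_periodic x); try lia.
  by congr nth; apply: eqmod_shift e _; lia.
Qed.

(** Level [n.+1] is [outer] and level [n] is [inner]: [M >= 2n + 3] leaves [M - 2n - 1 >= 2] copies
    of [u] between [lo] and [hi]. *)
Lemma level_step n M M' : n.+1 * 2 < M -> n.+1 * 2 < M' ->
  let lo := size w1 + n * size u in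
  let hi := size w1 + (M - n.+1) * size u in
  let hi' := size w1 + (M' - n.+1) * size u in
  [/\ lo + 2 * size u <= hi, lo + 2 * size u <= hi', eqmod (size u) hi hi'
    & [/\ size w1 + n.+1 * size u = lo + size u,
          size w1 + (M - n) * size u = hi + size u
        & size w1 + (M' - n) * size u = hi' + size u]].
Proof.
move=> ltM ltM' lo hi hi'; rewrite /lo /hi /hi'.
have -> : M - n = (M - n.+1).+1 by lia.
have -> : M' - n = (M' - n.+1).+1 by lia.
split; try nia; first by rewrite /eqmod !(addnC (size w1)) !modnMDl.
by rewrite !mulSn; split; lia.
Qed.

(** Each level implies the one below, down to level 0, where letters can be compared. *)
Lemma pumped_level n M M' i i' : n * 2 < M -> n * 2 < M' ->
  level n M M' i i' -> pumped M i = pumped M' i'.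
Proof.
elim: n i i' => [|n IH] i i' ltM ltM'; first exact: pumped_zone0.
have [le_hi le_hi' eq_hi [e1 e2 e3]] := level_step ltM ltM'.
rewrite e1 => /(outer_inner u_gt0 le_hi le_hi' eq_hi).
by rewrite -e2 -e3; apply: IH; lia.
Qed.

Lemma sat_pumped phi n M M' i i' :
  temporal_depth phi <= n -> n * 2 < M -> n * 2 < M' -> level n M M' i i' ->
  sat (pumped M) i phi -> sat (pumped M') i' phi.
Proof.
elim: phi n M M' i i' =>
  [p|f IHf|f IHf g IHg|f IHf g IHg|f IHf|f IHf g IHg|f IHf|f IHf g IHg]
  n M M' i i' /=.
- by move=> _ ltM ltM' /(pumped_level ltM ltM') ->.
(* Negation reverses the implication, so the induction hypothesis is used with the two words
   exchanged. *)
- move=> len ltM ltM' /zone_equiv_sym lev nf.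
  by move=> /(IHf _ _ _ _ _ len ltM' ltM lev).
- rewrite geq_max => /andP[lef leg] ltM ltM' lev [sf sg].
  by split; [apply: IHf lev sf | apply: IHg lev sg].
- rewrite geq_max => /andP[lef leg] ltM ltM' lev [sf|sg].
    by left; apply: IHf lev sf.
  by right; apply: IHg lev sg.
- case: n => // n lef ltM ltM'.
  have [le_hi le_hi' eq_hi [e1 e2 e3]] := level_step ltM ltM'.
  rewrite e1 => /(next_forth u_gt0 le_hi le_hi' eq_hi); rewrite -e2 -e3.
  by apply: IHf => //; lia.
- case: n => // n; rewrite ltnS geq_max => /andP[lef leg] ltM ltM'.
  have [le_hi le_hi' eq_hi [e1 e2 e3]] := level_step ltM ltM'.
  rewrite e1 => lev [j [le_ij sg sf]].
  have [j' [le_j' in_j' back]] :=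
    until_forth u_gt0 le_hi le_hi' eq_hi lev le_ij.
  rewrite -e2 -e3 in in_j' back.
  exists j'; split=> // [|k' /back[k /sf sk in_k]].
    by apply: IHg in_j' sg => //; lia.
  by apply: IHf in_k sk => //; lia.
- case: n => // n lef ltM ltM'.
  have [le_hi le_hi' eq_hi [e1 e2 e3]] := level_step ltM ltM'.
  rewrite e1 => lev [i_gt0 sf].
  have [i'_gt0 lev'] := previous_forth u_gt0 le_hi le_hi' eq_hi lev i_gt0.
  split=> //; rewrite -e2 -e3 in lev'.
  by apply: IHf lev' sf => //; lia.
- case: n => // n; rewrite ltnS geq_max => /andP[lef leg] ltM ltM'.
  have [le_hi le_hi' eq_hi [e1 e2 e3]] := level_step ltM ltM'.
  rewrite e1 => lev [j [le_ji sg sf]].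
  have [j' [le_j' in_j' back]] :=
    since_forth u_gt0 le_hi le_hi' eq_hi lev le_ji.
  rewrite -e2 -e3 in in_j' back.
  exists j'; split=> // [|k' /back[k /sf sk in_k]].
    by apply: IHg in_j' sg => //; lia.
  by apply: IHf in_k sk => //; lia.
Qed.

Lemma pos_equiv_level n M M' i i' : n <= M -> n <= M' ->
  pos_equiv n w1 u M M' i i' -> level n M M' i i'.
Proof.
move=> leM leM' [_]; move: (size u) (size w1) => L a.
(* Writing [M] as [n + m] turns the integer difference in the borders into the natural [m]. *)
have [m ->] : exists m, M = n + m by exists (M - n); lia.
have [m' ->] : exists m', M' = n + m' by exists (M' - n); lia.
rewrite !addKn.
case=> [[lt_i _ e]|[ge_i ge_i' e]|[[lo_i hi_i] [lo_i' hi_i'] e]].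
- exact: ZonePrefix.
- by apply: ZoneSuffix; nia.
- apply: ZoneMiddle; try nia.
  move: e; rewrite mod0n /eqmod; case: (leqP i' i) => [le_i|/ltnW le_i].
    by rewrite distnEl // => /eqP ?; apply/eqP; rewrite eqn_mod_dvd.
  by rewrite distnEr // => /eqP ?; apply/esym/eqP; rewrite eqn_mod_dvd.
Qed.

End Pumping.

Theorem theorem2 (AT : Type) (sigma1 s : seq (letter AT))
    (sigma2 : omega_word (letter AT)) (M M' N i i' : nat)
    (s_nonempty : s <> [::]) (N_ge2 : 2 <= N)
    (M_ge : 2 * N + 1 <= M) (M'_ge : 2 * N + 1 <= M')
    (equiv_ii' : pos_equiv N sigma1 s M M' i i')
    (phi : pltl AT) (depth_phi : temporal_depth phi <= N) :
  sat (omega_cat (sigma1 ++ word_pow s M) sigma2) i phi <->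
  sat (omega_cat (sigma1 ++ word_pow s M') sigma2) i' phi.
Proof.
have s_gt0 : 0 < size s by case: s s_nonempty {equiv_ii'}.
have lev : zone_equiv (size s) (size sigma1 + N * size s)
    (size sigma1 + (M - N) * size s) (size sigma1 + (M' - N) * size s) i i'.
  by apply: pos_equiv_level equiv_ii'; lia.
split; first by apply: sat_pumped lev => //; lia.
(* The converse is the same implication with the two words exchanged. *)
by apply: sat_pumped (zone_equiv_sym lev) => //; lia.
Qed.
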